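(* Let $X$ be a Hausdorff Baire space which admits a point-finite cover by meager subsets of $X$ that is $CA(\mathrm{Baire})$. Then there exists a co-meager subset $B \subseteq X$ which admits a Kuratowski partition.
   Context: A Baire space is a topological space in which the Baire category theorem holds (no nonempty open set is meager). A set $A \subseteq X$ is co-meager in $X$ if $X \setminus A$ is meager in $X$. A subset $U$ of a space $Y$ has the Baire property in $Y$ if $U = V \triangle M$ for some open $V \subseteq Y$ and some meager $M \subseteq Y$. A family $\mathcal{A}$ of subsets of $Y$ is $CA(\mathrm{Baire})$ if $\bigcup \mathcal{A}'$ has the Baire property in $Y$ for every subfamily $\mathcal{A}' \subseteq \mathcal{A}$. A family of subsets of $Y$ is point-finite if every point of $Y$ lies in only finitely many of its members. A Kuratowski partition of a space $Y$ is a partition $\mathcal{F}$ of $Y$ into meager subsets of $Y$ such that $\mathcal{F}$ is $CA(\mathrm{Baire})$; for $B \subseteq X$ this is understood with respect to the subspace topology on $B$. *)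

(* Defs.v *)
From HB Require Import structures.
From mathcomp Require Import all_boot all_order all_algebra.
From mathcomp Require Import all_classical all_analysis.

Set Implicit Arguments.
Unset Strict Implicit.
Unset Printing Implicit Defensive.

Local Open Scope classical_set_scope.

Section Category.
Context {Y : topologicalType}.
Implicit Types (A U V M : set Y) (F G : set (set Y)).

Definition nowhere_dense A := interior (closure A) = set0.

Definition meager A :=
  exists2 N : nat -> set Y,
    (forall n, nowhere_dense (N n)) & A = \bigcup_n N n.

Definition comeager A := meager (~` A).

Definition baire_property U :=
  exists V M, [/\ open V, meager M & U = V `+` M].

(* Families of subsets are sets of sets, i.e. families in the sense of
   [\bigcup_(A in F) A], [cover F id] and [partition F id]. *)
Definition CA_Baire F :=
  forall G, G `<=` F -> baire_property (\bigcup_(A in G) A).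

Definition point_finite F :=
  forall y, finite_set [set A | F A /\ A y].

Definition kuratowski_partition F :=
  [/\ partition F id [set: Y], forall A, F A -> meager A & CA_Baire F].

End Category.

Definition baire_space (Y : topologicalType) :=
  forall U : set Y, open U -> U !=set0 -> ~ meager U.

(* Main.v *)
Require Import Defs.
From HB Require Import structures.
From mathcomp Require Import all_boot all_order all_algebra.
From mathcomp Require Import all_classical all_analysis.

Set Implicit Arguments.
Unset Strict Implicit.
Unset Printing Implicit Defensive.

Local Open Scope classical_set_scope.

(* Say that a subfamily T of the cover C cannot be split on an open set V if
   almost every point of V lies in the union of T and, for every subfamily S of
   T, almost no point of V lies both in a member of S and in a member of T
   outside S. If g picks for each point x of V a member of T containing x,
   then, for every S, the set where g x is in S agrees on V, up to a meager
   set, with the union of the members of S in T, so it has the Baire property: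
   the fibres of g form a Kuratowski partition of a co-meager subset of V.

   Every nonempty open set contains a nonempty open V on which some T cannot be
   split. Indeed point-finiteness gives an n and an open set on which, everywhere
   nonmeagerly, at most n members of C contain x; whenever T splits, passing to
   S lowers this bound n, so splitting stops. By the Banach category theorem
   these local solutions can be glued along a maximal disjoint family of such
   open sets V. *)

(** * Meager sets, the Banach category theorem and the Baire property *)

Section Meager.
Context {Y : topologicalType}.
Implicit Types (A B N M O U V W : set Y).

Lemma nowhere_denseP N : nowhere_dense N <->
  forall O, open O -> O !=set0 ->
    exists V, [/\ open V, V !=set0, V `<=` O & V `&` N = set0].
Proof.
split=> [N0 O oO [x Ox]|H].
  have [V [Vx oV VN]] : exists V, [/\ V !=set0, open V & V `<=` O `\` closure N].
    exists (O `\` closure N); split=> //; last first.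
      by rewrite setDE; apply: openI => //; apply/closed_openC/closed_closure.
    apply/set0P/eqP; rewrite setD_eq0 => ON.
    suff : interior (closure N) x by rewrite N0.
    by move: ON; rewrite open_subsetE //; exact.
  exists V; split=> //; first by move=> y /VN[].
  rewrite -subset0 => y [/VN[_ nNy] Ny]; exact/nNy/subset_closure.
rewrite /nowhere_dense -subset0 => x Ix.
have [V [oV [y Vy] VI VN]] := H _ (open_interior (closure N)) (ex_intro _ x Ix).
have [z [Nz Vz]] := interior_subset (VI _ Vy) V (open_nbhs_nbhs (conj oV Vy)).
by have : set0 z by rewrite -VN.
Qed.

Lemma nowhere_denseS A B : A `<=` B -> nowhere_dense B -> nowhere_dense A.
Proof.
move=> AB /nowhere_denseP nB; apply/nowhere_denseP => O oO O0.
have [V [oV V0 VO VB]] := nB O oO O0; exists V; split=> //.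
by rewrite -subset0 => x [Vx /AB Bx]; rewrite -VB.
Qed.

Lemma meager_coverP A : meager A <->
  exists2 N : nat -> set Y, forall n, nowhere_dense (N n) & A `<=` \bigcup_n N n.
Proof.
split=> [[N nN ->]|[N nN AN]]; first by exists N.
exists (fun n => N n `&` A) => [n|]; first exact: nowhere_denseS (nN n).
by rewrite -setI_bigcupl setIidr.
Qed.

Lemma meagerS A B : A `<=` B -> meager B -> meager A.
Proof.
move=> AB [N nN BE]; apply/meager_coverP; exists N => //.
by rewrite -BE.
Qed.

Lemma nowhere_dense_meager A : nowhere_dense A -> meager A.
Proof. by move=> nA; exists (fun=> A) => //; rewrite bigcup_const. Qed.

Lemma meager0 : meager (@set0 Y).
Proof. by apply: nowhere_dense_meager; rewrite /nowhere_dense closure0 interior0. Qed.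

Lemma meager_bigcup (A : nat -> set Y) :
  (forall n, meager (A n)) -> meager (\bigcup_n A n).
Proof.
move=> mA.
have /choice[N HN] : forall n, exists N : nat -> set Y,
    (forall k, nowhere_dense (N k)) /\ A n = \bigcup_k N k.
  by move=> n; have [N ? ?] := mA n; exists N.
apply/meager_coverP.
(* The pairs of indices are coded by natural numbers; a number coding no pair contributes [set0]. *)
exists (fun k => if unpickle k is Some p then N p.1 p.2 else set0) => [k|x [n _]].
  case: unpickle => [p|]; first exact: (HN p.1).1.
  by rewrite /nowhere_dense closure0 interior0.
rewrite (HN n).2 => -[k _ Nx].
by exists (pickle (n, k)) => //; rewrite pickleK.
Qed.

Lemma meagerU A B : meager A -> meager B -> meager (A `|` B).
Proof.
move=> mA mB; have := @meager_bigcup (fun n => if n is 0 then A else B).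
move=> /(_ _)/meagerS; apply; last by case.
by move=> x [?|?]; [exists 0 | exists 1].
Qed.

(** By maximality: a nonempty [W] in [Q] that met no member of [F] could be added to [F]. *)
Lemma maximal_disjoint_open (Q : set (set Y)) :
  exists F : set (set Y), [/\ F `<=` Q, trivIset F id &
    forall W, Q W -> W !=set0 -> exists2 V, F V & W `&` V !=set0].
Proof.
have [F [FQ tF maxF]] := ex_maximal_disjoint_subcollection id Q.
exists F; split=> // W QW W0; apply: contrapT => /forall2NP H.
have WF V : F V -> ~ (W `&` V !=set0) by move=> FV; case: (H V).
apply: (maxF (F `|` [set W])); first split.
- by move=> V; left.
- by move=> /(_ W (or_intror erefl))/WF; rewrite setIid.
- by move=> V [/FQ//|->].
- move=> V V' [FV|->] [FV'|->] //; first exact: tF.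
    by rewrite setIC => VW; case: (WF V FV).
  by move=> VW; case: (WF V' FV').
Qed.

(** An open set meeting some [V] in [F] is first shrunk into [V], where by disjointness only [N V]
    remains to be avoided. *)
Lemma nowhere_dense_disjoint_bigcup (F : set (set Y)) (N : set Y -> set Y) :
    (forall V, F V -> open V) -> trivIset F id ->
    (forall V, F V -> N V `<=` V /\ nowhere_dense (N V)) ->
  nowhere_dense (\bigcup_(V in F) N V).
Proof.
move=> oF tF HN; apply/nowhere_denseP => O oO O0.
have [[V [FV [x [Ox Vx]]]]|H] := pselect (exists V, F V /\ O `&` V !=set0).
  have [NV /nowhere_denseP] := HN V FV.
  move=> /(_ _ (openI oO (oF V FV)) (ex_intro _ x (conj Ox Vx))).
  move=> [W [oW W0 WOV WN]]; exists W; split=> //; first by move=> y /WOV[].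
  rewrite -subset0 => y [Wy [V' FV' NV'y]]; rewrite -WN; split=> //.
  suff -> : V = V' by [].
  by apply: tF => //; exists y; split; [case: (WOV _ Wy) | exact: (HN V' FV').1].
exists O; split=> //; rewrite -subset0 => y [Oy [V FV NVy]].
by apply: H; exists V; split=> //; exists y; split=> //; exact: (HN V FV).1.
Qed.

(** Taking the union over [V] first, for a fixed index [k], gives a nowhere dense set, so only a
    countable union is left. *)
Lemma meager_disjoint_bigcup (F : set (set Y)) (A : set Y -> set Y) :
    (forall V, F V -> open V) -> trivIset F id ->
    (forall V, F V -> A V `<=` V /\ meager (A V)) ->
  meager (\bigcup_(V in F) A V).
Proof.
move=> oF tF HA.
have /choice[N HN] : forall V, exists N : nat -> set Y,
    F V -> (forall k, nowhere_dense (N k)) /\ A V = \bigcup_k N k.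
  move=> V; have [/HA[_ [N ? ?]]|nF] := pselect (F V); first by exists N.
  by exists (fun=> set0).
apply/meager_coverP; exists (fun k => \bigcup_(V in F) N V k) => [k|x [V FV]].
  apply: nowhere_dense_disjoint_bigcup => // V FV; have [nN AE] := HN V FV.
  split=> //; apply: subset_trans (HA V FV).1.
  by rewrite AE => x ?; exists k.
by rewrite (HN V FV).2 => -[k _ ?]; exists k => //; exists V.
Qed.

Lemma nowhere_dense_setD_dense U D : open D ->
    (forall V, open V -> V !=set0 -> V `<=` U -> V `&` D !=set0) ->
  open U -> nowhere_dense (U `\` D).
Proof.
move=> oD H oU; apply/nowhere_denseP => O oO O0.
have [OU|OU] := pselect (O `&` U !=set0).
  exists (O `&` U `&` D); split.
  - by apply: openI => //; exact: openI.
  - by apply: H => //; exact: openI.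
  - by move=> x [[]].
  - by rewrite -subset0 => x [[_ Dx] [_ /(_ Dx)]].
exists O; split=> //; rewrite -subset0 => x [Ox [Ux _]].
by apply: OU; exists x.
Qed.

(* The Banach category theorem. *)
Lemma locally_meager A U : open U ->
    (forall V, open V -> V !=set0 -> V `<=` U ->
      exists W, [/\ open W, W !=set0, W `<=` V & meager (A `&` W)]) ->
  meager (A `&` U).
Proof.
move=> oU H.
pose Q : set (set Y) := [set W | open W /\ meager (A `&` W)].
have [F [FQ tF maxF]] := maximal_disjoint_open Q.
have oF V : F V -> open V by move=> /FQ[].
pose D := \bigcup_(V in F) V.
have mAD : meager (\bigcup_(V in F) (A `&` V)).
  by apply: meager_disjoint_bigcup => // V FV; split; [move=> x []|case: (FQ V FV)].
have nUD : nowhere_dense (U `\` D).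
  apply: nowhere_dense_setD_dense => //; first exact: bigcup_open.
  move=> V oV V0 /(H V oV V0)[W [oW W0 WV mW]].
  have [V' FV' [x [Wx V'x]]] := maxF W (conj oW mW) W0.
  by exists x; split; [exact: WV | exists V'].
apply: meagerS (meagerU mAD (nowhere_dense_meager nUD)).
move=> x [Ax Ux]; have [[V FV Vx]|nDx] := pselect (D x).
  by left; exists V.
by right.
Qed.

Lemma meager_bigcup_open A (F : set (set Y)) :
    (forall V, F V -> open V /\ meager (A `&` V)) ->
  meager (A `&` \bigcup_(V in F) V).
Proof.
move=> HF; apply: locally_meager => [|V oV [x Vx] VF].
  by apply: bigcup_open => V /HF[].
have [W FW Wx] := VF x Vx; have [oW mW] := HF W FW.
exists (V `&` W); split; [exact: openI|by exists x|by move=> y []|].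
by apply: meagerS mW => y [? []].
Qed.

Lemma baire_propertyP A : baire_property A <->
  exists V, [/\ open V, meager (A `\` V) & meager (V `\` A)].
Proof.
split=> [[V [M [oV mM ->]]]|[V [oV m1 m2]]].
  exists V; split=> //; apply: meagerS mM => x.
    by case=> -[] // [].
  case=> Vx nVM; apply: contrapT => nMx; apply: nVM; left; split=> //.
exists V, (A `+` V); split=> //; first exact: meagerU.
by rewrite [A `+` V]setYC setYA setYK set0Y.
Qed.

Lemma open_baire_property U : open U -> baire_property U.
Proof.
by move=> oU; apply/baire_propertyP; exists U; split=> //; rewrite setDv; exact: meager0.
Qed.

Lemma baire_propertyI A B :
  baire_property A -> baire_property B -> baire_property (A `&` B).
Proof.
move=> /baire_propertyP[U [oU mAU mUA]] /baire_propertyP[V [oV mBV mVB]].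
apply/baire_propertyP; exists (U `&` V); split; first exact: openI.
  apply: meagerS (meagerU mAU mBV) => x [[Ax Bx] nUV].
  by have [Ux|nUx] := pselect (U x); [right; split=> // Vx; apply: nUV|left].
apply: meagerS (meagerU mUA mVB) => x [[Ux Vx] nAB].
by have [Ax|nAx] := pselect (A x); [right; split=> // Bx; apply: nAB|left].
Qed.

Lemma baire_property_meager_diff A B : meager (A `\` B) -> meager (B `\` A) ->
  baire_property A -> baire_property B.
Proof.
move=> mAB mBA /baire_propertyP[U [oU mAU mUA]].
apply/baire_propertyP; exists U; split=> //.
  apply: meagerS (meagerU mBA mAU) => x [Bx nUx].
  by have [Ax|nAx] := pselect (A x); [right|left].
apply: meagerS (meagerU mUA mAB) => x [Ux nBx].
by have [Ax|nAx] := pselect (A x); [right|left].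
Qed.

(** The open approximation of [A] is the union of all open subsets of [D] in which [A] is co-meager.
    Both error sets are locally meager, hence meager. *)
Lemma baire_property_bigcup_open A (F : set (set Y)) :
    (forall V, F V -> open V /\ baire_property (A `&` V)) ->
  baire_property (A `&` \bigcup_(V in F) V).
Proof.
move=> HF; set D := \bigcup_(V in F) V.
pose Q : set (set Y) := [set W | [/\ open W, W `<=` D & meager (~` A `&` W)]].
have mQ : meager (~` A `&` \bigcup_(W in Q) W).
  by apply: meager_bigcup_open => W [].
apply/baire_propertyP; exists (\bigcup_(W in Q) W); split.
- by apply: bigcup_open => W [].
- have -> : (A `&` D) `\` \bigcup_(W in Q) W = (A `\` \bigcup_(W in Q) W) `&` D.
    by rewrite setIDAC setIDA.
  apply: meager_bigcup_open => V FV.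
  have [oV /baire_propertyP[G [oG mG1 mG2]]] := HF V FV; split=> //.
  apply: meagerS mG1 => x [[Ax nQx] Vx]; split=> // Gx; apply: nQx.
  (* As [G] approximates [A] on [V], almost every point of [G] in [V] is in [A]. *)
  exists (G `&` V) => //; split; first exact: openI.
    by move=> y [_ Vy]; exists V.
  by apply: meagerS mG2 => y [nAy [Gy Vy]]; split=> // -[].
- apply: meagerS mQ => x [[W QW Wx] nADx]; split; last by exists W.
  by move=> Ax; apply: nADx; split=> //; case: QW => _ + _; exact.
Qed.

End Meager.

(** * Passing to a dense subspace *)

Section Subspace.
Context {X : topologicalType} (B : set X).
Hypothesis denseB : forall O, open O -> O !=set0 -> O `&` B !=set0.

(** Density of [B] keeps the trace on [B] of an open set avoiding [N] nonempty. *)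
Lemma nowhere_dense_subspace (N : set X) :
  nowhere_dense N -> nowhere_dense (set_val @^-1` N : set B).
Proof.
move=> /nowhere_denseP nN; apply/nowhere_denseP => _ [U oU <-] [b Ub].
have [V [oV V0 VU VN]] := nN U oU (ex_intro _ (set_val b) Ub).
have [x [Vx Bx]] := denseB oV V0.
exists (set_val @^-1` V); split.
- by exists V.
- by exists (SigSub (mem_set Bx)).
- by move=> y /VU.
- by rewrite -preimage_setI VN preimage_set0.
Qed.

Lemma meager_subspace (M : set X) :
  meager M -> meager (set_val @^-1` M : set B).
Proof.
move=> [N nN ->]; exists (fun n => set_val @^-1` N n).
  by move=> n; exact: nowhere_dense_subspace.
by rewrite preimage_bigcup.
Qed.

Lemma baire_property_subspace (A : set X) :
  baire_property A -> baire_property (set_val @^-1` A : set B).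
Proof.
move=> /baire_propertyP[V [oV mAV mVA]]; apply/baire_propertyP.
exists (set_val @^-1` V); split; first by exists V.
- exact: (meager_subspace mAV).
- exact: (meager_subspace mVA).
Qed.

End Subspace.

Lemma comeager_dense (X : topologicalType) (B O : set X) :
  baire_space X -> comeager B -> open O -> O !=set0 -> O `&` B !=set0.
Proof.
move=> bX cB oO O0; apply: contrapT => OB; apply: (bX O oO O0).
by apply: meagerS cB => x Ox Bx; apply: OB; exists x.
Qed.

(** * Finding unsplit subfamilies of a point-finite cover *)

Section PointFinite.
Context {X : topologicalType} (C : set (set X)).
Implicit Types (S T : set (set X)) (V W : set X).
Hypotheses (baireX : baire_space X) (pfC : point_finite C) (caC : CA_Baire C).

Let union T := \bigcup_(A in T) A.
(** This is a true count only for finite sets, which point-finiteness ensures for [T] inside [C]. *)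
Let mult T x := size (finmap.enum_fset (fset_set [set A | T A /\ A x])).

Definition unsplit V T := [/\ T `<=` C, meager (V `\` union T) &
  forall S, S `<=` T -> meager (V `&` (union S `&` union (T `\` S)))].

Lemma mult_lt S T x : T `<=` C -> S `<=` T -> union (T `\` S) x ->
  (mult S x < mult T x)%N.
Proof.
move=> TC ST [A [TA nSA] Ax].
have finT : finite_set [set A | T A /\ A x].
  by apply: sub_finite_set (pfC x) => D [/TC CD Dx].
have finS : finite_set [set A | S A /\ A x].
  by apply: sub_finite_set finT => D [/ST TD Dx].
apply: finmap.fproper_ltn_card; rewrite finmap.fproperEneq; apply/andP; split; last first.
  by rewrite -fset_set_sub // => D [/ST TD Dx].
apply/eqP => /(fset_set_inj finS finT) E.
by have [] : [set A | S A /\ A x] A by rewrite E.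
Qed.

(** Descent on [n]: if some [S] splits [T], then [S] satisfies the same hypotheses with a smaller
    bound on a smaller open set. At [n = 0] the last hypothesis is contradictory. *)
Lemma exists_unsplit_of_mult n V T :
    open V -> V !=set0 -> T `<=` C -> meager (V `\` union T) ->
    (forall W, open W -> W !=set0 -> W `<=` V ->
      ~ meager ([set x | mult T x < n]%N `&` W)) ->
  exists V' T', [/\ open V', V' !=set0, V' `<=` V & unsplit V' T'].
Proof.
elim: n V T => [|n IHn] V T oV V0 TC mVT nmT.
  case: (nmT V oV V0 (@subset_refl _ V)).
  by apply: meagerS meager0 => x [].
have [|/existsNP[S]] :=
  pselect (forall S, S `<=` T -> meager (V `&` (union S `&` union (T `\` S)))).
  by move=> sT; exists V, T; split.
move=> /not_implyP[ST nmE].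
set E := V `&` _ in nmE.
(* Here CA(Baire) enters: it turns the nonmeager set [E] into an open set [G] in which [E] is
   co-meager. *)
have /baire_propertyP[G [oG mEG mGE]] : baire_property E.
  apply: baire_propertyI; first exact: open_baire_property.
  apply: baire_propertyI; apply: caC => A; first by move=> /ST/TC.
  by move=> [/TC].
have [x [Gx Vx]] : G `&` V !=set0.
  apply: contrapT => GV; apply: nmE; apply: meagerS mEG => x Ex; split=> // Gx.
  by apply: GV; exists x; split=> //; case: Ex.
have [||||W oW W0 WGV mW|V' [T' [? ? V'GV ?]]] := IHn (G `&` V) S.
- exact: openI.
- by exists x.
- exact: subset_trans TC.
- by apply: meagerS mGE => y [[Gy Vy] nSy]; split=> // -[_ []].
- apply: (nmT W oW W0); first by move=> y /WGV[].
  apply: meagerS (meagerU mW mGE) => y [Ty Wy].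
  (* A point of [E] lies in a member of [T] outside [S], so its multiplicity drops strictly. *)
  have [[_ [Sy TSy]]|nEy] := pselect (E y); last first.
    by right; split=> //; case: (WGV _ Wy).
  by left; split=> //=; apply: leq_trans (mult_lt TC ST TSy) _.
- by exists V', T'; split=> // y /V'GV[].
Qed.

(** The countably many sets [mult C x < n] exhaust [V], so one is nonmeager in [V]. By
    [locally_meager] it is everywhere nonmeager in some open [W], and the descent starts there from
    [C] itself. *)
Lemma exists_unsplit V : cover C id = [set: X] -> open V -> V !=set0 ->
  exists V' T, [/\ open V', V' !=set0, V' `<=` V & unsplit V' T].
Proof.
move=> covC oV V0.
have [n nm] : exists n, ~ meager ([set x | mult C x < n]%N `&` V).
  apply/existsNP => mn; apply: (baireX oV V0).
  apply: meagerS (meager_bigcup mn) => x Vx.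
  by exists (mult C x).+1 => //; split=> /=.
have [W [oW W0 WV nmW]] : exists W, [/\ open W, W !=set0, W `<=` V &
    forall O, open O -> O !=set0 -> O `<=` W ->
      ~ meager ([set x | mult C x < n]%N `&` O)].
  apply: contrapT => H; apply: nm; apply: locally_meager => // W oW W0 WV.
  apply: contrapT => H'; apply: H; exists W; split=> // O oO O0 OW mO.
  by apply: H'; exists O.
have [||V' [T [? ? V'W ?]]] := exists_unsplit_of_mult oW W0 _ _ nmW.
- by [].
- suff -> : union C = setT by rewrite setDT; exact: meager0.
  by rewrite -covC.
- by exists V', T; split=> //; exact: subset_trans WV.
Qed.

End PointFinite.

(* [set (set B)] is over the subtype [set_type B], which the library equips
   with the subspace topology. *)
Theorem theorem2 (X : topologicalType) (hausX : hausdorff_space X)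
    (baireX : baire_space X)
    (coverX : exists C : set (set X),
      [/\ cover C id = [set: X], forall A, C A -> meager A,
          point_finite C & CA_Baire C]) :
  exists B : set X, comeager B /\
    exists F : set (set B), kuratowski_partition F.
Proof.
have [C [covC mC pfC caC]] := coverX.
pose union (T : set (set X)) := \bigcup_(A in T) A.
pose Q : set (set X) := [set V | open V /\ exists T, unsplit C V T].
have [F [FQ tF maxF]] := maximal_disjoint_open Q.
have /choice[T HT] : forall V, exists T, F V -> unsplit C V T.
  move=> V; have [/FQ[_ [T]]|nFV] := pselect (F V); first by exists T.
  by exists set0.
have oF V : F V -> open V by move=> /FQ[].
pose D := \bigcup_(V in F) V.
have nD : nowhere_dense (setT `\` D).
  apply: nowhere_dense_setD_dense; [exact: bigcup_open | | exact: openT].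
  move=> V oV V0 _.
  have [W [U [oW W0 WV uW]]] := exists_unsplit baireX pfC caC covC oV V0.
  have [V' FV' [x [Wx V'x]]] : exists2 V, F V & W `&` V !=set0.
    by apply: maxF => //; split=> //; exists U.
  by exists x; split; [exact: WV|exists V'].
(* Only the points covered by the subfamily chosen for their [V] are kept. *)
pose B := \bigcup_(V in F) (V `&` union (T V)).
have cB : comeager B.
  have mDB : meager (\bigcup_(V in F) (V `\` union (T V))).
    apply: meager_disjoint_bigcup => // V FV; split; first by move=> x [].
    by case: (HT V FV).
  apply: meagerS (meagerU mDB (nowhere_dense_meager nD)) => x nBx.
  have [[V FV Vx]|nDx] := pselect (D x); last by right.
  by left; exists V => //; split=> // Tx; apply: nBx; exists V.
exists B; split=> //.
(* Disjointness of [F] lets one choice of [A] serve every [V]; outside [B] the value is a dummy. *)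
have /choice[g Hg] : forall x, exists A,
    forall V, F V -> (V `&` union (T V)) x -> T V A /\ A x.
  move=> x; have [[V FV [Vx [A TA Ax]]]|nBx] := pselect (B x).
    exists A => V' FV' [V'x _]; suff <- : V = V' by [].
    by apply: tF => //; exists x.
  by exists set0 => V FV Tx; exfalso; apply: nBx; exists V.
have gC x : B x -> C (g x) /\ g x x.
  move=> [V FV Tx]; have [Tg gx] := Hg x V FV Tx; split=> //.
  by case: (HT V FV) => + _ _; exact.
have bpg (S : set (set X)) : baire_property (B `&` [set x | S (g x)]).
  have <- : B `&` [set x | S (g x)] `&` D = B `&` [set x | S (g x)].
    by apply/setIidPl => x [[V FV [Vx _]] _]; exists V.
  apply: baire_property_bigcup_open => V FV; split; first exact: oF.
  have [TC mVT sT] := HT V FV.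
  apply: (@baire_property_meager_diff _ (V `&` union (S `&` T V))).
  (* Such an [x] lies in [A], which is in [S], and in [g x], which is not: the overlap that is
     meager because [T V] is unsplit. *)
  - apply: meagerS (sT _ (@subIsetr _ S (T V))) => x [[Vx [A [SA TA] Ax]] nSgx].
    have TVx : (V `&` union (T V)) x by split=> //; exists A.
    have [Tg gx] := Hg x V FV TVx.
    split=> //; split; first by exists A.
    exists (g x) => //; split=> // -[Sg _]; apply: nSgx.
    by split=> //; split=> //; exists V.
  (* This difference is empty, as [g x] is itself a member of [S] containing [x]. *)
  - apply: meagerS meager0 => x [[[[V' FV' TVx'] Sg] Vx] nSTx]; apply: nSTx.
    have VV' : V = V' by apply: tF => //; exists x; split=> //; case: TVx'.
    rewrite -VV' in TVx'; have [Tg gx] := Hg x V FV TVx'.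
    by split=> //; exists (g x).
  - apply: baire_propertyI; first by apply: open_baire_property; exact: oF.
    by apply: caC => A [_ /TC].
have dB := @comeager_dense _ B _ baireX cB.
(* The fibres of [g] on [B]; empty ones are dropped, as a partition requires. *)
exists [set P | P !=set0 /\ exists A, P = set_val @^-1` (B `&` [set x | g x = A])].
split.
- split.
  + apply/seteqP; split=> // b _.
    exists (set_val @^-1` (B `&` [set x | g x = g (set_val b)])).
      split; last by exists (g (set_val b)).
      by exists b; split=> //=; exact/set_mem/valP.
    by split=> //=; exact/set_mem/valP.
  + by move=> _ _ [_ [A ->]] [_ [A' ->]] [b [[_ /= <-] [_ /= <-]]].
  + by move=> P [].
- move=> P [+ [A PE]]; rewrite {}PE => -[b [Bb /= gb]].
  have [+ _] := gC _ Bb; rewrite gb => CA.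
  (* The fibre over [A] is contained in the meager set [A]. *)
  apply: (meager_subspace dB); apply: meagerS (mC A CA) => x [Bx /= <-].
  by have [] := gC x Bx.
- move=> G GF.
  pose S : set (set X) := [set A | G (set_val @^-1` (B `&` [set x | g x = A]))].
  suff -> : \bigcup_(P in G) P = set_val @^-1` (B `&` [set x | S (g x)]).
    exact: (baire_property_subspace dB).
  apply/seteqP; split=> [b [P GP Pb]|b [Bb Sb]].
    have [_ [A PE]] := GF P GP; move: Pb GP; rewrite PE => -[Bb /= gb] GA.
    by split=> //; rewrite /S /= gb.
  by exists (set_val @^-1` (B `&` [set x | g x = g (set_val b)])).
Qed.
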